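(* Let $G$ be a connected $(C_4,\text{diamond})$-free graph on $n$ vertices and let $1\le k\le n-1$. Then $F_k(G)$ is uniquely reconstructible as the $k$-token graph of $G$.
   Context: For a graph $G$ on $n$ vertices and $1\le k\le n-1$, $F_k(G)$ is the graph on the $k$-subsets of $V(G)$ in which $A,B$ are adjacent iff $A\triangle B$ is an edge of $G$. A diamond is $K_4$ minus an edge; $(C_4,\text{diamond})$-free means no induced $4$-cycle and no induced diamond. For graphs $H,G$ let $\operatorname{Iso}(H,G)$ be the set of isomorphisms $H\to G$ and $\operatorname{Aut}(G)$ the automorphism group. For $\psi\in\operatorname{Iso}(H,G)$ let $\iota(\psi):V(F_k(H))\to V(F_k(G))$, $\iota(\psi)(A)=\{\psi(v):v\in A\}$. Let $\mathfrak{c}$ be the map sending each $k$-subset $A$ of $V(G)$ to $V(G)\setminus A$ (an isomorphism $F_k(G)\to F_{n-k}(G)$). A $k$-token reconstruction of a graph $F$ is a pair $(G',\varphi)$ with $\varphi$ an isomorphism $F\to F_k(G')$. Two $k$-token reconstructions $(G,\varphi)$ and $(G,\psi)$ of $F$ are equivalent if there exists $s\in\operatorname{Aut}(G)$ with $\psi=\iota(s)\circ\varphi$ or $\psi=\mathfrak{c}\circ\iota(s)\circ\varphi$. A graph $F$ is uniquely reconstructible as the $k$-token graph of $G$ if any two $k$-token reconstructions of $F$ of the form $(G,\cdot)$ are equivalent. *)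

(* Defs.v *)
From mathcomp Require Import all_boot.
Set Implicit Arguments. Unset Strict Implicit. Unset Printing Implicit Defensive.

Definition simple_graph (V : finType) (e : rel V) : Prop :=
  symmetric e /\ irreflexive e.

Definition connected_graph (V : finType) (e : rel V) : Prop :=
  forall x y : V, connect e x y.

Definition C4_free (V : finType) (e : rel V) : Prop :=
  ~ exists a b c d : V,
    [/\ uniq [:: a; b; c; d],
        [&& e a b, e b c, e c d & e d a] & (~~ e a c) && (~~ e b d)].

Definition diamond_free (V : finType) (e : rel V) : Prop :=
  ~ exists a b c d : V,
    [/\ uniq [:: a; b; c; d],
        [&& e a b, e a c, e a d, e b c & e b d] & ~~ e c d].

Notation tok V k := {A : {set V} | #|A| == k}.

Definition tok_adj (V : finType) (e : rel V) (k : nat) (A B : tok V k) : bool :=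
  [exists u : V, exists v : V,
     e u v && (((val A :\: val B) :|: (val B :\: val A)) == [set u; v])].

Definition tok_iso (V : finType) (e : rel V) (k : nat) (f : tok V k -> tok V k) : Prop :=
  bijective f /\ forall A B, tok_adj e (f A) (f B) = tok_adj e A B.

Definition graph_aut (V : finType) (e : rel V) (s : V -> V) : Prop :=
  bijective s /\ forall x y, e (s x) (s y) = e x y.

(* equivalence of k-token reconstructions (G, phi), (G, psi):
   psi = iota(s) o phi  or  psi = c o iota(s) o phi  for some s in Aut(G);
   maps are compared as maps into subsets of V. *)
Definition equiv_recon (V : finType) (e : rel V) (k : nat)
    (phi psi : tok V k -> tok V k) : Prop :=
  exists s : V -> V, graph_aut e s /\
    ((forall A, val (psi A) = s @: val (phi A)) \/
     (forall A, val (psi A) = ~: (s @: val (phi A)))).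

Definition uniquely_reconstructible (V : finType) (e : rel V) (k : nat) : Prop :=
  forall phi psi : tok V k -> tok V k,
    tok_iso e phi -> tok_iso e psi -> equiv_recon e phi psi.

(* Main.v *)
(* Let f be an automorphism of the token graph. Because G has no induced C4 or diamond,
   two moves at a set A use disjoint edges of G iff the resulting neighbours of A are
   distinct, non-adjacent and have a common neighbour other than A. Hence f preserves
   disjointness and incidence of moves, and it maps a move that commutes with another one
   to the same move on both sides of the square. The remaining way in which a token can
   get past an edge ab is through a or b, along a star hexagon or a path c - a - b - d; for
   these the image is controlled as well, the only obstruction (a hexagon of two tokens on
   a star being sent to one token on a 6-cycle) forcing G to be a star, which has no
   6-cycle. So f induces a map on the oriented edges of G that preserves incidence. At each
   vertex it either preserves or exchanges the roles of tokens and holes, and the choice is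
   the same at all vertices; after composing with complementation if necessary, the common
   source of the images of the edges leaving a defines s(a), and f(A) = s(A). *)

Require Import Defs.
From mathcomp Require Import all_boot.
Set Implicit Arguments. Unset Strict Implicit. Unset Printing Implicit Defensive.

Ltac split_bool :=
  unfold is_true in *;
  repeat match goal with
  | H : _ && _ = true |- _ => case/andP: H => ? ?; unfold is_true in *
  | H : _ /\ _ |- _ => destruct H
  | H : ~~ _ = true |- _ => apply negbTE in H
  end.

(* Decides Boolean identities between memberships in explicitly modified sets,
   by splitting on all equalities between elements and all memberships. *)
Ltac mem_cases :=
  split_bool; rewrite ?inE;
  repeat match goal with
  | H : (?x == ?x) = false |- _ => rewrite eqxx in H; discriminate H
  | H : ?b = true, H' : ?b = false |- _ => rewrite H in H'; discriminate H'
  | |- context [@eq_op ?T ?x ?y] =>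
      destruct (@eqP T x y) as [?|?]; [subst|]; rewrite /= ?andbT ?andbF ?orbT ?orbF ?eqxx
  | |- context [@in_mem ?T ?x ?A] =>
      let E := fresh "E" in destruct (@in_mem T x A) eqn:E; rewrite /= ?andbT ?andbF ?orbT ?orbF
  end; try solve [done | congruence].

(** * Moves of a token and pairs of moves on disjoint edges *)

Section TokenGraph.
Variables (V : finType) (e : rel V).
Implicit Types (A B C D X Y : {set V}) (u v w : V).

(** All the token graphs of the graph are treated at once, on arbitrary subsets. A neighbour is
    recorded by an oriented move, so that token and hole can be told apart; complementation
    exchanges the two. *)
Definition mv A u v := v |: (A :\ u).
Definition moves A u v := [&& u \in A, v \notin A & e u v].
Definition adj A B := [exists u, exists v, moves A u v && (B == mv A u v)].
(* For neighbours B, C of A this says that the two moves use disjoint edges of the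
   underlying graph (indepE); it is the only place where the absence of induced C4
   and diamonds enters, and being graph-theoretic it is preserved by automorphisms. *)
Definition indep A B C :=
  [&& B != C, ~~ adj B C & [exists D, [&& D != A, adj B D & adj C D]]].

Hypotheses (e_sym : symmetric e) (e_irr : irreflexive e).
Hypothesis common_nbrs : forall u w v v',
  u != w -> v != v' -> e u v -> e u v' -> e w v -> e w v' -> e v v'.

Lemma in_mv A u v w : (w \in mv A u v) = (w == v) || (w \in A) && (w != u).
Proof. by rewrite !inE andbC. Qed.

Lemma adjP A B : reflect (exists u v, moves A u v /\ B = mv A u v) (adj A B).
Proof.
apply: (iffP existsP) => [[u /existsP[v /andP[m /eqP->]]]|[u [v [m ->]]]].
  by exists u, v.
by exists u; apply/existsP; exists v; rewrite m eqxx.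
Qed.

Lemma edge_neq u v : e u v -> u != v.
Proof. by apply: contraTneq => ->; rewrite e_irr. Qed.

Lemma moves_neq A u v : moves A u v -> u != v.
Proof. by case/and3P=> _ _ /edge_neq. Qed.

Lemma moves_adj A u v : moves A u v -> adj A (mv A u v).
Proof. by move=> m; apply/adjP; exists u, v. Qed.

Lemma mvK A u v : u \in A -> v \notin A -> mv (mv A u v) v u = A.
Proof. move=> uA vA; apply/setP=> w; rewrite !in_mv; mem_cases. Qed.

Lemma moves_back A u v : moves A u v -> moves (mv A u v) v u.
Proof.
move=> m; have n := moves_neq m; case/and3P: m => uA vA euv.
by rewrite /moves !in_mv e_sym euv !eqxx (negPf n) andbF.
Qed.

Lemma mvC A u v u' v' : u \in A -> v \notin A -> u' \in A -> v' \notin A ->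
  u != u' -> v != v' -> mv (mv A u v) u' v' = mv (mv A u' v') u v.
Proof. move=> *; apply/setP=> w; rewrite !in_mv; mem_cases. Qed.

Lemma moves_mv A u v u' v' : moves A u v -> moves A u' v' -> u != u' -> v != v' ->
  moves (mv A u v) u' v'.
Proof.
case/and3P=> uA vA _ /and3P[uA' vA' euv'] nu nv.
by rewrite /moves !in_mv euv' uA' (negPf vA') (eq_sym v') (negPf nv) (eq_sym u' u) nu orbT.
Qed.

Lemma mv_inj A u v p q : moves A u v -> moves A p q -> mv A u v = mv A p q ->
  u = p /\ v = q.
Proof.
move=> m m'; have n := moves_neq m; have n' := moves_neq m'.
case/and3P: m => uA vA _; case/and3P: m' => pA qA _ /setP E; split.
  move: (E u); rewrite !in_mv uA eqxx (negPf n) /=.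
  by case: eqP pA qA => [->|]; rewrite ?uA //=; case: eqP.
by move: (E v); rewrite !in_mv (negPf vA) eqxx /= orbF; case: eqP.
Qed.

Lemma moves_setC A u v : moves (~: A) v u = moves A u v.
Proof. by rewrite /moves !inE negbK e_sym; case: (u \in A); rewrite ?andbF. Qed.

Lemma mv_setC A u v : u \in A -> v \notin A -> mv (~: A) v u = ~: mv A u v.
Proof. move=> uA vA; apply/setP=> w; rewrite in_setC !in_mv in_setC; mem_cases. Qed.

Lemma adj_setC A B : adj (~: A) (~: B) = adj A B.
Proof.
suff H C D : adj C D -> adj (~: C) (~: D).
  by apply/idP/idP => [/H|/H]; rewrite ?setCK.
case/adjP=> u [v [m ->]]; apply/adjP; exists v, u.
by rewrite moves_setC mv_setC //; case/and3P: m.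
Qed.

Lemma indep_setC A B C : indep A B C -> indep (~: A) (~: B) (~: C).
Proof.
case/and3P=> nBC naBC /existsP[D /and3P[nDA aBD aCD]].
rewrite /indep adj_setC (inj_eq (@setC_inj _)) nBC naBC; apply/existsP; exists (~: D).
by rewrite (inj_eq (@setC_inj _)) !adj_setC nDA aBD aCD.
Qed.

Lemma indep_moves A u v u' v' : moves A u v -> moves A u' v' ->
  u != u' -> v != v' -> indep A (mv A u v) (mv A u' v').
Proof.
move=> m m' nu nv; have [uA vA _] := and3P m; have [uA' vA' _] := and3P m'.
have n : u != v' by apply: contraNneq vA' => <-.
have n1 : u != v := moves_neq m.
apply/and3P; split.
- by apply/eqP=> /setP/(_ v); rewrite !in_mv eqxx (negPf nv) (negPf vA).
- apply/negP=> /adjP[p [q [/and3P[pB qB _] /setP E]]].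
  have := E u; have := E v'; rewrite !in_mv !eqxx uA nu (negPf n) (negPf n1) (negPf vA').
  rewrite (eq_sym v' v) (negPf nv) andbF !orbF /= => /esym/eqP v'q /esym/eqP uq.
  by rewrite uq v'q eqxx in n.
- apply/existsP; exists (mv (mv A u v) u' v'); apply/and3P; split.
  + have nvu' : v != u' by apply: contraNneq vA => ->.
    by apply/eqP=> /setP/(_ v); rewrite !in_mv eqxx nvu' (negPf vA) orbT.
  + exact/moves_adj/moves_mv.
  + rewrite mvC //; apply/moves_adj/moves_mv => //; by rewrite eq_sym.
Qed.

(** If [v] and [v'] were adjacent, the two sets would be too. Otherwise a common neighbour [D] other
    than [A] exhibits a second common neighbour of [v] and [v'] besides [u]: the vertex [q] when the
    token on [v] moves on to [D], and the vertex [p] when another token does. Then [common_nbrs]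
    makes [v] and [v'] adjacent after all. *)
Lemma indep_same_src A u v v' : moves A u v -> moves A u v' ->
  ~~ indep A (mv A u v) (mv A u v').
Proof.
move=> m m'; apply/negP=> /and3P[nBC naBC /existsP[D /and3P[nDA]]].
have [uA vA euv] := and3P m; have [_ vA' euv'] := and3P m'.
have n := moves_neq m; have n' := moves_neq m'.
have nv : v != v' by apply: contraNneq nBC => ->.
have nevv : e v v' = false.
  apply: contraNF naBC => evv; apply/adjP; exists v, v'; split.
    by rewrite /moves !in_mv eqxx evv (negPf vA') (eq_sym v') (negPf nv).
  by apply/setP=> w; rewrite !in_mv; mem_cases.
case/adjP=> p [q [/and3P[pB qB epq] DB]] /adjP[p' [q' [/and3P[pC qC epq'] DC]]].
have E w : (w \in mv (mv A u v) p q) = (w \in mv (mv A u v') p' q') by rewrite -DB -DC.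
have /= Ev := E v; have /= Ev' := E v'; have /= Eq := E q; have Ep := E p.
rewrite !in_mv in pB qB pC qC Ev Ev' Eq Ep.
case: (eqVneq p v) => [pv|npv].
  have nqu : q != u.
    by apply: contraNneq nDA => qu; rewrite DB pv qu mvK.
  have nqv' : q != v'.
    apply: contraFneq nevv => qv'; by rewrite -pv -qv'.
  subst p.
  rewrite !eqxx (eq_sym v' v) (negPf nv) (negPf vA') (eq_sym v' q) (negPf nqv') /= in Ev'.
  have v'p' : v' = p' by apply/eqP; apply: contraFT (esym Ev') => ->; rewrite orbT.
  rewrite negb_or nqu andbT in qB; case/andP: qB => nqv qA.
  rewrite eqxx (negPf nqv') (negPf qA) /= orbF in Eq; move/esym/eqP: Eq => qq'.
  have := common_nbrs _ nv euv euv'; move/(_ q); rewrite eq_sym nqu !(e_sym q) epq v'p' qq' epq'.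
  by move/(_ isT isT isT); rewrite -v'p' nevv.
rewrite !eqxx (negPf nv) (negPf vA) (eq_sym v p) npv orbT /= orbF in Ev.
move/esym/eqP: Ev => vq'.
have np'v' : v' != p'.
  by apply: contraFneq nevv => v'p'; rewrite e_sym v'p' vq'.
rewrite !eqxx (eq_sym v' v) (negPf nv) (negPf vA') np'v' orbT /= orbF in Ev'.
move/eqP: Ev' => v'q.
rewrite (negPf npv) /= in pB; case/andP: pB => pA npu.
have pp' : p = p'.
  apply/eqP; apply: contraT => npp'; move: Ep.
  rewrite eqxx andbF orbF npp' pA npu /= andbT !orbT => /eqP pq.
  by rewrite pq -v'q (negPf vA') in pA.
have := common_nbrs npu nv; rewrite {1}vq' pp' epq' euv euv' -pp' v'q epq.
by move/(_ isT isT isT isT); rewrite -v'q nevv.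
Qed.

(** Moves with a common target become moves with a common source after complementation. *)
Lemma indepE A u v u' v' : moves A u v -> moves A u' v' ->
  indep A (mv A u v) (mv A u' v') = (u != u') && (v != v').
Proof.
move=> m m'; case: (eqVneq u u') => [uu|nu] /=.
  by apply/negbTE; rewrite -uu; apply: indep_same_src; rewrite // uu.
case: (eqVneq v v') => [vv|nv] /=; last exact: indep_moves.
apply/negP=> /indep_setC; have [uA vA _] := and3P m; have [uA' vA' _] := and3P m'.
rewrite -!mv_setC // -vv; apply/negP/indep_same_src; by rewrite moves_setC // vv.
Qed.

(** Sizes need not be preserved, so that composing with complementation stays within the class
    ([aut_setC]) and every statement has a mirror version with sources and targets exchanged. *)
Definition token_aut (f : {set V} -> {set V}) :=
  bijective f /\ forall A B, adj (f A) (f B) = adj A B.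

Definition maps_move (f : {set V} -> {set V}) A u v p q :=
  [/\ moves A u v, moves (f A) p q & f (mv A u v) = mv (f A) p q].

Lemma mv_mv A u v w : u \in A -> v \notin A -> mv (mv A u v) v w = mv A u w.
Proof. move=> uA vA; apply/setP=> t; rewrite !in_mv; mem_cases. Qed.

Lemma mv_id A u : u \in A -> mv A u u = A.
Proof. move=> uA; apply/setP=> t; rewrite !in_mv; mem_cases. Qed.

(** When the two moves share an end, the difference of the resulting sets has at most one element:
    [r] for a common source, [s] for a common target. *)
Lemma mv_corner G i j s r w w' : moves G i j -> moves G s r -> s = i \/ r = j ->
  w \in mv G s r -> w \notin mv G i j -> w' \in mv G s r -> w' \notin mv G i j -> w = w'.
Proof.
move=> /and3P[iG jG _] /and3P[sG rG _] H h1 h2 h3 h4; apply/eqP; apply: contraT => n.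
by case: H => E; subst; move: h1 h2 h3 h4; rewrite !in_mv; mem_cases.
Qed.

(** * Automorphisms and twisted hexagons *)

Section Automorphism.
Variable f : {set V} -> {set V}.
Hypothesis f_aut : token_aut f.
Let maps_move := maps_move f.

Lemma aut_inj : injective f.
Proof. by case: f_aut => /bij_inj. Qed.

Lemma maps_move_ex A u v : moves A u v -> exists p q, maps_move A u v p q.
Proof.
move=> m; have : adj (f A) (f (mv A u v)) by rewrite (proj2 f_aut) moves_adj.
by case/adjP=> p [q [m' E]]; exists p, q.
Qed.

Lemma aut_indep A B C : indep (f A) (f B) (f C) = indep A B C.
Proof.
have [[g fK gK] fadj] := f_aut.
rewrite /indep (inj_eq aut_inj) fadj; congr [&& _, _ & _].
apply/existsP/existsP => -[D H].
  by exists (g D); move: H; rewrite -{1 2 3}(gK D) (inj_eq aut_inj) !fadj.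
by exists (f D); rewrite (inj_eq aut_inj) !fadj.
Qed.

Lemma maps_move_disjoint A u v p q u' v' p' q' : maps_move A u v p q -> maps_move A u' v' p' q' ->
  (u != u') && (v != v') = (p != p') && (q != q').
Proof.
case=> m1 m2 E [m1' m2' E'].
by rewrite -(indepE m1 m1') -aut_indep E E' (indepE m2 m2').
Qed.

Lemma maps_move_back A u v p q : maps_move A u v p q -> maps_move (mv A u v) v u q p.
Proof.
case=> m1 m2 E; split; first exact: moves_back.
  by rewrite E; apply: moves_back.
case/and3P: m1 => uA vA _; case/and3P: m2 => pA qA _.
by rewrite E !mvK.
Qed.

(** The images of the sides at a corner of the square are disjoint moves, by [maps_move_disjoint].
    The opposite corner of the image is reached in two ways, and on one of them [p] leaves and [q]
    enters for good; so the last move on the other way must be [p -> q]. *)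
Lemma maps_move_slide A u v p q u' v' : maps_move A u v p q -> moves A u' v' -> u != u' -> v != v' ->
  maps_move (mv A u' v') u v p q.
Proof.
move=> H m' nu nv; have [m1 m2 E] := H.
have [p' [q' H']] := maps_move_ex m'; have [_ m2' E'] := H'.
have [r [s K]] := maps_move_ex (moves_mv m1 m' nu nv).
have m3 : moves (mv A u' v') u v by apply: moves_mv; rewrite // eq_sym.
have [r' [s' K']] := maps_move_ex m3.
have := maps_move_disjoint H H'; rewrite nu nv => /esym/andP[npp' nqq'].
have [uA vA _] := and3P m1; have [uA' vA' _] := and3P m'.
have [pA qA _] := and3P m2; have [pA' qA' _] := and3P m2'.
have n1 : v != u' by apply: contraNneq vA => ->.
have n2 : u != v' by apply: contraNneq vA' => <-.
have := maps_move_disjoint (maps_move_back H) K; rewrite n1 n2 => /esym/andP[nqr nps].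
have := maps_move_disjoint (maps_move_back H') K'; rewrite eq_sym n2 eq_sym n1 => /esym/andP[nqr' nps'].
have [_ m4 E4] := K; have [_ m4' E4'] := K'.
have Q : mv (mv (f A) p q) r s = mv (mv (f A) p' q') r' s'.
  by rewrite -E -E' -E4 -E4' mvC.
have npq := moves_neq m2.
have := congr1 (fun S : {set V} => q \in S) Q; have := congr1 (fun S : {set V} => p \in S) Q.
rewrite /= !in_mv !eqxx (negPf nps) (negPf npq) npp' (negPf nqq') nqr (negPf qA) pA !orbT /=.
rewrite ?andbF ?orbF => Ep /esym/eqP Eq.
have {}Ep : p = r' by apply/eqP; apply: contraFT (esym Ep) => ->; rewrite orbT.
by move: K'; rewrite -Ep -Eq; case; split.
Qed.

(* Two tokens on a star with centre a and leaves b, x, y run through the hexagon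
   {x,y} {a,y} {b,y} {a,b} {b,x} {a,x}; here A is the set containing {a,y}. Its first
   four vertices are mapped to a single token walking along x' a' b' y', although in the
   hexagon the moves at {a,y} share the token and those at {b,y} share the hole. *)
Definition twisted a b x y A a' b' x' y' :=
  [/\ b != x, y != b, maps_move A a b a' b', maps_move A a x a' x' & maps_move (mv A a b) y a b' y'].

(* The whole image hexagon is then a single token walking around a 6-cycle. *)
Lemma twisted_hexagon a b x y A a' b' x' y' : twisted a b x y A a' b' x' y' ->
  exists p q, twisted a x y b (mv (mv A a b) y a) y' p b' q /\ maps_move (mv A a x) y a x' q.
Proof.
case=> nbx nyb Hab Hax Hya.
have [mab mab' EB] := Hab; have [max max' EC] := Hax; have [mya mya' ED] := Hya.
have [aA bA eab] := and3P mab; have [_ xA eax] := and3P max.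
have [a'A b'A _] := and3P mab'; have [_ x'A _] := and3P max'.
have nab := moves_neq mab; have nya := moves_neq mya; have nax := moves_neq max.
have [yB aB eya] := and3P mya.
have yA : y \in A by move: yB; rewrite in_mv (negPf nyb) nya andbT.
have nyx : y != x by apply: contraNneq xA => <-.
set B := mv A a b in Hya mya yB aB ED mya' EB *; set C := mv A a x in EC *.
set D := mv B y a in ED *.
have mDy : moves D a y by apply: moves_back.
have Hay : maps_move D a y y' b' by apply: maps_move_back.
have mDx : moves D a x.
  by rewrite /moves /D /B !in_mv eax; clear -aA xA nax nbx; mem_cases.
have mCy : moves C y a.
  by rewrite /moves /C !in_mv eya; clear -yA nya nax; mem_cases.
have [r [s K]] := maps_move_ex mDx; have [r2 [s2 K2]] := maps_move_ex mCy.
have EG : mv C y a = mv (mv D a x) b a.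
  by rewrite /C /D /B; apply/setP=> t; rewrite !in_mv;
  clear -aA xA yA bA nyb nbx nya nyx nab nax; mem_cases.
have mEb : moves (mv D a x) b a.
  rewrite /moves /D /B !in_mv (e_sym b) eab; clear -aA xA bA nab nax nbx nyb; mem_cases.
have [j [i L]] := maps_move_ex mEb.
have /esym h1 := maps_move_disjoint Hay K; rewrite eqxx /= in h1.
have /esym h2 := maps_move_disjoint (maps_move_back Hax) K2; rewrite eqxx andbF in h2.
have /esym h3 : (a != a) && (y != b) = (s2 != i) && (r2 != j).
  by apply: (maps_move_disjoint (maps_move_back K2)); rewrite EG; apply: maps_move_back.
rewrite eqxx /= in h3.
have /esym h4 := maps_move_disjoint (maps_move_back K) L; rewrite eqxx andbF in h4.
have xC : x \in C by rewrite in_mv eqxx.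
have bD : b \in D by rewrite /D /B !in_mv eqxx (eq_sym b y) nyb orbT.
have xE : x \in mv D a x by rewrite in_mv eqxx.
have bC : b \notin C by rewrite in_mv (negPf nbx) (negPf bA).
have [b'B y'B _] := and3P mya'.
have ED' : f D = mv (f A) a' y' by rewrite ED EB mv_mv.
have n1 : y' != a'.
  apply: contraNneq bA => E; have /aut_inj <- // : f D = f A.
  by rewrite ED' E mv_id.
have n2 : y' != x'.
  apply: contraNneq bC => E; have /aut_inj <- // : f D = f C.
  by rewrite ED' E EC.
have y'A : y' \notin f A.
  by move: y'B; rewrite EB in_mv n1 andbT negb_or => /andP[].
have n3 : y' != b' by apply: contraNneq y'B => ->.
have n4 : b' != x'.
  apply: contraNneq bC => E; have /aut_inj <- : f B = f C by rewrite EB EC E.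
  by rewrite in_mv eqxx.
have [_ m5 EE] := K; have [rD sD _] := and3P m5; have [_ m6 EG2] := K2.
have [r2C s2C _] := and3P m6; have [_ m7 EG3] := L.
have EG4 : f (mv C y a) = mv (f (mv D a x)) j i by rewrite EG.
have m8 := moves_back m6; have m9 := moves_back m5; have m10 := moves_back m7.
have fCE : f C = mv (f (mv C y a)) s2 r2 by rewrite EG2 mvK.
have fDE : f D = mv (f (mv D a x)) s r by rewrite EE mvK.
have fEG : f (mv D a x) = mv (f (mv C y a)) i j.
  by rewrite EG4 mvK //; case/and3P: m7.
(* Otherwise [s = b'], and both [x'] and [r] lie in [f C] but not in [f (mv D a x)]. These are
   neighbours of [f (mv C y a)] by moves sharing an end, so [mv_corner] gives [x' = r], although [r]
   lies in [f A] and [x'] does not. *)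
have ry : r = y'.
  apply/eqP; apply: contraT => nry; move: h1; rewrite (eq_sym y') nry /= => /negbFE/eqP bs.
  move: rD; rewrite ED' in_mv (negPf nry) /= => /andP[rA nra].
  suff xr : x' = r by rewrite xr rA in x'A.
  have H : s2 = i \/ r2 = j.
    by move: h3; case: (eqVneq s2 i) => [->|_ /negbFE/eqP]; [left|right].
  rewrite -EG2 in m8; rewrite -EG3 -EG in m10.
  apply: (mv_corner m10 m8 H); rewrite -?fCE -?fEG ?EC ?EE ?ED' -?bs !in_mv.
  - by rewrite eqxx.
  - by rewrite eq_sym (negPf n4) (eq_sym x') (negPf n2) (negPf x'A).
  - by rewrite rA nra orbT.
  - by rewrite eqxx andbF orbF; apply: contraNneq b'A => <-.
have rx : r2 = x'.
  apply/eqP; apply: contraT => nrx; move: h2; rewrite (eq_sym x') nrx /= => /negbFE/eqP as2.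
  move: r2C; rewrite EC in_mv (negPf nrx) /= => /andP[rA nra].
  suff yr : y' = r2 by rewrite yr rA in y'A.
  have H : s = j \/ r = i.
    by move: h4; case: (eqVneq s j) => [->|_ /negbFE/eqP]; [left|right].
  rewrite -EE in m9.
  apply: (mv_corner m7 m9 H); rewrite -?fDE -?EG4 ?EG2 ?EC ?ED' -?as2 !in_mv.
  - by rewrite eqxx.
  - by rewrite (negPf n1) (negPf n2) (negPf y'A).
  - by rewrite rA nra orbT.
  - by rewrite eqxx andbF orbF.
subst r r2.
have fE : f (mv D a x) = mv (f A) a' s by rewrite EE ED' mv_mv.
have fG : f (mv C y a) = mv (f A) a' s2 by rewrite EG2 EC mv_mv.
have ns : s != a'.
  apply: contraNneq xA => E; have /aut_inj <- // : f (mv D a x) = f A.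
  by rewrite fE E mv_id.
have ns2 : s2 != a'.
  apply: contraNneq xA => E; have /aut_inj <- : f (mv C y a) = f A.
    by rewrite fG E mv_id.
  by rewrite in_mv xC (eq_sym x y) nyx orbT.
have nss : s != s2.
  apply/eqP=> E; have /aut_inj /setP/(_ a) : f (mv D a x) = f (mv C y a).
    by rewrite fE fG E.
  by rewrite !in_mv !eqxx (negPf nax) andbF.
have sA : s \notin f A.
  by move: sD; rewrite ED' in_mv ns andbT negb_or => /andP[].
have s2A : s2 \notin f A.
  by move: s2C; rewrite EC in_mv ns2 andbT negb_or => /andP[].
(* Both sides arise from [f A] by moving [a'], to [s] before the last move and to [s2] after it;
   hence that move is [s -> s2]. *)
have := congr1 (fun S : {set V} => s \in S) EG4.
have := congr1 (fun S : {set V} => s2 \in S) EG4.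
rewrite /= fE fG !in_mv !eqxx (negPf nss) (eq_sym s2 s) (negPf nss) (negPf sA) (negPf s2A) /= orbF.
move=> /esym/eqP s2i /esym/negbT; rewrite negb_or negbK => /andP[_ /eqP sj].
subst i j; exists s, s2; split=> //; split=> //; by rewrite eq_sym.
Qed.

(** Lets each of the three leaves take the place of [b] in [twisted_leaf]. *)
Lemma twisted_rot a b x y A a' b' x' y' : twisted a b x y A a' b' x' y' ->
  exists A a' b' x' y', twisted a x y b A a' b' x' y'.
Proof. by case/twisted_hexagon=> p [q [H _]]; exists (mv (mv A a b) y a), y', p, b', q. Qed.

(* Any other move at b slides along half of the hexagon; its image would have to be
   incident to two opposite edges of the 6-cycle but disjoint from the others. *)
Lemma twisted_leaf a b x y A a' b' x' y' : twisted a b x y A a' b' x' y' ->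
  forall z, e b z -> z = a.
Proof.
move=> Htw z ebz; apply/eqP; apply: contraT => nza.
have [p [q [Htw' Hya2]]] := twisted_hexagon Htw.
have [nbx nyb Hab Hax Hya] := Htw; have [nxy _ Hax3 Hay3 Hba3] := Htw'.
have [mab mab' EB] := Hab; have [max max' EC] := Hax; have [mya mya' ED] := Hya.
have [aA bA eab] := and3P mab; have [_ xA eax] := and3P max.
have [a'A b'A _] := and3P mab'; have [_ x'A _] := and3P max'.
have [yB aB eya] := and3P mya.
have nab := moves_neq mab; have nya := moves_neq mya; have nax := moves_neq max.
have yA : y \in A by move: yB; rewrite in_mv (negPf nyb) nya andbT.
have nbz := edge_neq ebz.
have xE : x \in mv (mv (mv (mv A a b) y a) a x) b a.
  by rewrite !in_mv eqxx (eq_sym x b) nbx orbT.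
(* Here [x -> b] joins two vertices of the hexagon, so its image must have source [x']; yet it is
   disjoint from [y -> a], whose image also has source [x']. For [z = y] the same happens with
   [y -> b], [a -> x] and the source [a']. *)
case: (eqVneq z x) => [zx|nzx].
  subst z; have m : moves (mv A a x) x b.
    by rewrite /moves !in_mv (e_sym x) ebz eqxx (negPf nbx) (negPf bA).
  have [r [s [m1 m2 E]]] := maps_move_ex m.
  have /esym := maps_move_disjoint (And3 m1 m2 E) Hya2; rewrite nxy (eq_sym b a) nab => /andP[nrx _].
  have x'r : x' = r.
    apply/eqP; apply: contraT => nx'r; have := congr1 (fun S : {set V} => x' \in S) E.
    rewrite mv_mv // EB EC /= !in_mv eqxx nx'r !orbT (negPf x'A) /= orbF => /eqP x'b'.
    have /aut_inj/setP/(_ b) : f (mv A a b) = f (mv A a x) by rewrite EB EC x'b'.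
    by rewrite !in_mv eqxx (negPf nbx) (negPf bA).
  by rewrite x'r eqxx in nrx.
case: (eqVneq z y) => [zy|nzy].
  subst z; have m : moves A y b by rewrite /moves yA bA e_sym.
  have [r [s [m1 m2 E]]] := maps_move_ex m.
  have /esym := maps_move_disjoint (And3 m1 m2 E) Hax; rewrite nya nbx => /andP[nra _].
  have a'r : a' = r.
    apply/eqP; apply: contraT => na'r; have := congr1 (fun S : {set V} => a' \in S) E.
    have -> : mv A y b = mv (mv A a b) y a.
      by apply/setP=> t; rewrite !in_mv; clear -aA bA yA nya nyb nab; mem_cases.
    have n : a' != y'.
      apply/eqP=> E1; have /aut_inj/setP/(_ b) : f (mv (mv A a b) y a) = f A.
        by rewrite ED EB mv_mv // -E1 mv_id.
      by rewrite !in_mv eqxx (eq_sym b y) nyb orbT (negPf bA).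
    by rewrite ED EB mv_mv // /= !in_mv (negPf n) eqxx na'r a'A !orbT.
  by rewrite a'r eqxx in nra.
case: (boolP (z \in A)) => zA.
  have m : moves A z b by rewrite /moves zA bA e_sym.
  have [r [s Hz]] := maps_move_ex m.
  have := maps_move_disjoint Hz Hax; rewrite nza nbx => /esym/andP[nra _].
  have := maps_move_disjoint Hz Hab; rewrite eqxx andbF nra => /esym/negbFE/eqP sb; subst s.
  have HzC := maps_move_slide Hz max nza nbx.
  have [_ mC _] := HzC; have [rC _ _] := and3P mC.
  have [m2 m2' _] := Hya2; have [_ qC _] := and3P m2'.
  have nba : b != a by rewrite eq_sym.
  have HzG := maps_move_slide HzC m2 nzy nba.
  have EG : mv (mv A a x) y a = mv (mv (mv (mv A a b) y a) a x) b a.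
    by apply/setP=> t; rewrite !in_mv;
    clear -aA xA yA bA nyb nbx nya nxy nab nax; mem_cases.
  rewrite EG in HzG.
  have := maps_move_disjoint HzG (maps_move_back Hba3); rewrite eqxx andbF.
  have -> : r != q by apply: contraNneq qC => <-.
  move/esym/negbFE/eqP => bp; subst p.
  have [_ _ EE] := Hax3.
  have /aut_inj/setP/(_ x) : f (mv (mv (mv A a b) y a) a x) = f (mv A a b).
    by have [b'B y'B _] := and3P mya'; rewrite EE ED mv_mv // mv_id.
  by rewrite !in_mv eqxx (eq_sym x b) (negPf nbx) (negPf xA).
have nby : b != y by rewrite eq_sym.
have m : moves (mv A a b) b z.
  by rewrite /moves !in_mv eqxx ebz (eq_sym z) (negPf nbz) (negPf zA).
have [r [s Hz]] := maps_move_ex m.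
have := maps_move_disjoint Hz Hya; rewrite nby nza => /esym/andP[nrb _].
have := maps_move_disjoint Hz (maps_move_back Hab); rewrite eqxx nrb => /esym/negbFE/eqP sa; subst s.
have HzD := maps_move_slide Hz mya nby nza.
have [max3 max3' EE] := Hax3; have [_ pD _] := and3P max3'.
have [_ mD _] := HzD; have [rD aD _] := and3P mD.
have nba : b != a by rewrite eq_sym.
have HzE := maps_move_slide HzD max3 nba nzx.
have := maps_move_disjoint HzE Hba3; rewrite eqxx.
have -> : r != p by apply: contraNneq pD => <-.
move/esym/negbFE/eqP => aq; subst q.
have [_ _ EG] := Hba3.
have /aut_inj/setP/(_ x) : f (mv (mv (mv (mv A a b) y a) a x) b a) = f A.
  have [_ y'B _] := and3P mya'; have [b'B _ _] := and3P mya'.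
  rewrite EG EE mv_mv ?ED ?EB.
  - by rewrite mv_mv ?mv_mv ?mv_id // -?EB.
  - by rewrite in_mv eqxx.
  - by move: pD; rewrite ED EB.
by rewrite xE (negPf xA).
Qed.

(** A further neighbour [z] of [a] can replace a leaf of the hexagon, [y] if it carries a token and
    [x] if not, and the new hexagon is again twisted. After rotation [twisted_leaf] applies to
    [z]. *)
Lemma twisted_star a b x y A a' b' x' y' : twisted a b x y A a' b' x' y' ->
  forall z w, e a z -> e z w -> w = a.
Proof.
move=> Htw z w eaz ezw; move: (Htw) => [nbx nyb Hab Hax Hya].
have [mab mab' EB] := Hab; have [max max' EC] := Hax; have [mya mya' ED] := Hya.
have [aA bA eab] := and3P mab; have [_ xA eax] := and3P max.
have [yB aB eya] := and3P mya; have nya := moves_neq mya.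
have nab := moves_neq mab; have nax := moves_neq max; have naz := edge_neq eaz.
have [a'A b'A _] := and3P mab'; have [b'B y'B _] := and3P mya'.
case: (eqVneq z b) => [zb|nzb]; first by subst z; apply: (twisted_leaf Htw).
case: (eqVneq z x) => [zx|nzx].
  by have [? [? [? [? [? H]]]]] := twisted_rot Htw; subst z; apply: (twisted_leaf H).
case: (eqVneq z y) => [zy|nzy].
  have [? [? [? [? [? /twisted_rot [? [? [? [? [? H]]]]]]]]]] := twisted_rot Htw.
  by subst z; apply: (twisted_leaf H).
case: (boolP (z \in A)) => zA.
  have m : moves (mv A a b) z a.
    by rewrite /moves !in_mv zA (eq_sym z a) naz (negPf nab) eqxx andbF e_sym eaz orbT.
  have [r [s Hz]] := maps_move_ex m.
  have := maps_move_disjoint Hz Hya.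
  have := maps_move_disjoint Hz (maps_move_back Hab); rewrite eqxx !andbF.
  have n : a' != y'.
    apply/eqP=> E1; have /aut_inj/setP/(_ b) : f (mv (mv A a b) y a) = f A.
      by rewrite ED EB mv_mv // -E1 mv_id.
    by rewrite !in_mv eqxx (eq_sym b y) nyb orbT (negPf bA).
  case: (eqVneq r b') => [rb _ _|_ /= /esym/negbFE/eqP -> /esym/negbFE/eqP ay]; last first.
    by rewrite ay eqxx in n.
  subst r; have H : twisted a b x z A a' b' x' s by split.
  have [? [? [? [? [? /twisted_rot [? [? [? [? [? H']]]]]]]]]] := twisted_rot H.
  exact: (twisted_leaf H').
have m : moves A a z by rewrite /moves aA zA.
have [r [s Hz]] := maps_move_ex m.
have := maps_move_disjoint Hz Hax; have := maps_move_disjoint Hz Hab; rewrite eqxx /=.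
have n : b' != x'.
  apply/eqP=> E1; have /aut_inj/setP/(_ b) : f (mv A a b) = f (mv A a x).
    by rewrite EB EC E1.
  by rewrite !in_mv eqxx (negPf nbx) (negPf bA).
case: (eqVneq r a') => [rb _ _|_ /= /esym/negbFE/eqP -> /esym/negbFE/eqP ay]; last first.
  by rewrite ay eqxx in n.
subst r; have H : twisted a b z y A a' b' s y' by split; rewrite // eq_sym.
have [? [? [? [? [? H']]]]] := twisted_rot H.
exact: (twisted_leaf H').
Qed.

(* A twisted hexagon forces the graph to be a star, but a' and b' have degree at least 2. *)
Lemma not_twisted a b x y A a' b' x' y' : connected_graph e -> ~ twisted a b x y A a' b' x' y'.
Proof.
move=> conn Htw; have star := twisted_star Htw.
have near u : u = a \/ e a u.
  have [p pth ->] := connectP (conn a u).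
  elim/last_ind: p pth => [|p v IHp]; first by left.
  rewrite rcons_path last_rcons => /andP[/IHp[->|eal] elv]; first by right.
  by left; apply: star eal elv.
have leaf u w : u != a -> e u w -> w = a.
  by move=> /eqP nua euw; case: (near u) => // eau; apply: star eau euw.
move: (Htw) => [nbx nyb Hab Hax Hya].
have [mab mab' EB] := Hab; have [max max' EC] := Hax; have [mya mya' ED] := Hya.
have [aA bA eab] := and3P mab; have [_ xA eax] := and3P max.
have [a'A b'A eab'] := and3P mab'; have [_ _ eax'] := and3P max'.
have [_ _ eby'] := and3P mya'.
case: (eqVneq a' a) => [aa|naa]; last first.
  have bx : b' = x' by rewrite (leaf _ _ naa eab') (leaf _ _ naa eax').
  have /aut_inj/setP/(_ b) : f (mv A a b) = f (mv A a x).
    by rewrite EB EC bx.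
  by rewrite !in_mv eqxx (negPf nbx) (negPf bA).
have nba : b' != a by rewrite -aa eq_sym; apply: moves_neq mab'.
have ya : y' = a' by rewrite (leaf _ _ nba eby').
have /aut_inj/setP/(_ b) : f (mv (mv A a b) y a) = f A.
  by rewrite ED EB mv_mv // ya mv_id.
by rewrite !in_mv eqxx (eq_sym b y) nyb orbT (negPf bA).
Qed.

Lemma maps_move_fun A u v p q p' q' : maps_move A u v p q -> maps_move A u v p' q' -> p = p' /\ q = q'.
Proof. by case=> _ m E [_ m' E']; apply: mv_inj m m' _; rewrite -E -E'. Qed.

Lemma maps_move_onto A p q : moves (f A) p q -> exists u v, maps_move A u v p q.
Proof.
move=> m; have [[g fK gK] fadj] := f_aut.
have : adj A (g (mv (f A) p q)) by rewrite -fadj gK moves_adj.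
by case/adjP=> u [v [m' E]]; exists u, v; split; rewrite // -E gK.
Qed.

End Automorphism.

Lemma aut_setC f : token_aut f -> token_aut (fun A => ~: f A).
Proof.
case=> [[g fK gK] fadj]; split; last by move=> A B; rewrite adj_setC.
by exists (fun A => g (~: A)) => A; rewrite ?setCK ?fK ?gK ?setCK.
Qed.

Lemma maps_move_setC f A u v p q : maps_move f A u v p q -> maps_move (fun A => ~: f A) A u v q p.
Proof.
case=> m m' E; split; rewrite ?moves_setC ?E //.
by case/and3P: m' => pA qA _; rewrite mv_setC.
Qed.

Hypothesis conn : connected_graph e.

(** * Images of moves do not depend on the other tokens *)

(* Since no hexagon is twisted, the image of a star hexagon alternates between moves
   sharing a token and moves sharing a hole, hence is a star hexagon itself. *)
Lemma alternate f a b x y A a' b' x' r s : token_aut f -> b != x -> y != b ->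
  maps_move f A a b a' b' -> maps_move f A a x a' x' -> maps_move f (mv A a b) y a r s -> s = a'.
Proof.
move=> fa nbx nyb Hab Hax Hya.
have := maps_move_disjoint fa (maps_move_back Hab) Hya; rewrite eqxx andbF.
case: (eqVneq b' r) => [E _|_ /esym/negbFE/eqP->//].
by subst r; case: (not_twisted fa conn (And5 nbx nyb Hab Hax Hya)).
Qed.

Lemma alternate_dst f a b x y A a' b' x' r s : token_aut f -> b != x -> y != b ->
  maps_move f A a b b' a' -> maps_move f A a x x' a' -> maps_move f (mv A a b) y a r s -> r = a'.
Proof.
move=> fa nbx nyb /maps_move_setC Hab /maps_move_setC Hax /maps_move_setC Hya.
exact: (alternate (aut_setC fa) nbx nyb Hab Hax Hya).
Qed.

(** The two moves labelled [a -> b] are opposite edges of the star hexagon. Going round, [alternate]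
    and its mirror show that each image move starts or ends at [a']; comparing both ways to the last
    vertex shows that [b'] is the token removed there. *)
Lemma star_hop_aux f A a b x y a' b' x' : token_aut f -> y \in A -> y != a -> e a y -> b != x ->
  maps_move f A a b a' b' -> maps_move f A a x a' x' -> maps_move f (mv A y x) a b a' b'.
Proof.
move=> fa yA nya eay nbx Hab Hax.
have [mab mab' EB] := Hab; have [max max' EC] := Hax.
have [aA bA eab] := and3P mab; have [_ xA eax] := and3P max.
have [a'A b'A _] := and3P mab'; have [_ x'A _] := and3P max'.
have nab := moves_neq mab; have nax := moves_neq max.
have nyb : y != b by apply: contraNneq bA => <-.
have nyx : y != x by apply: contraNneq xA => <-.
have nb'x' : b' != x'.
  apply/eqP=> E; have /(aut_inj fa)/setP/(_ b) : f (mv A a b) = f (mv A a x).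
    by rewrite EB EC E.
  by rewrite !in_mv eqxx (negPf nbx) (negPf bA).
have mya : moves (mv A a b) y a.
  by rewrite /moves !in_mv e_sym eay; clear -aA yA nya nyb nab; mem_cases.
have [y' [r Hya]] := maps_move_ex fa mya.
have Er := alternate fa nbx nyb Hab Hax Hya; subst r.
have [_ mya' ED] := Hya; have [y'B a'B _] := and3P mya'.
have b'B : b' \in f (mv A a b) by rewrite EB in_mv eqxx.
have nb'y' : b' != y'.
  apply/eqP=> E; subst y'; have [_ _ E1] := maps_move_back Hab.
  have /(aut_inj fa)/setP/(_ b) : f (mv (mv A a b) b a) = f (mv (mv A a b) y a).
    by rewrite ED.
  by rewrite !in_mv !eqxx (eq_sym b a) (negPf nab) (eq_sym b y) nyb.
set D := mv (mv A a b) y a in ED *.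
have Day : mv D a y = mv A a b by rewrite /D mvK //; case/and3P: mya.
have mDx : moves D a x.
  by rewrite /moves /D !in_mv eax; clear -aA xA nax nbx; mem_cases.
have [r [w' HDx]] := maps_move_ex fa mDx.
have HDy := maps_move_back Hya; rewrite -/D in HDy.
have Hba : maps_move f (mv D a y) b a b' a' by rewrite Day; apply: maps_move_back.
have nby : b != y by rewrite eq_sym.
have Er : r = a'.
  have := maps_move_disjoint fa HDy HDx; rewrite eqxx.
  case: (eqVneq a' r) => [->//|_ /esym/negbFE/eqP E]; subst w'.
  by have E := alternate_dst fa nyx nby HDy HDx Hba; rewrite E eqxx in nb'y'.
subst r; have nxy : x != y by rewrite eq_sym.
have mEb : moves (mv D a x) b a.
  by rewrite /moves /D !in_mv (e_sym b) eab; clear -aA xA bA nab nax nbx nyb; mem_cases.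
have [u' [r Hu]] := maps_move_ex fa mEb.
have Er := alternate fa nxy nbx HDx HDy Hu; subst r.
have mCy : moves (mv A a x) y a.
  by rewrite /moves !in_mv (e_sym y) eay; clear -yA nya nax; mem_cases.
have nxb : x != b by rewrite eq_sym.
have [v' [r Hv]] := maps_move_ex fa mCy.
have Er := alternate fa nxb nyx Hax Hab Hv; subst r.
have EG : mv (mv A a x) y a = mv (mv D a x) b a.
  by rewrite /D; apply/setP=> t; rewrite !in_mv;
  clear -aA xA yA bA nyb nbx nya nyx nab nax; mem_cases.
have EG' : mv A y x = mv (mv A a x) y a.
  by apply/setP=> t; rewrite !in_mv;
  clear -aA xA yA bA nyb nbx nya nyx nab nax; mem_cases.
suff ub : u' = b' by rewrite EG' EG -ub; apply: maps_move_back.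
have [_ mv' Ev] := Hv; have [_ mu' Eu] := Hu; have [_ mw' Ew] := HDx.
have na'b' := moves_neq mab'.
have := congr1 (fun S : {set V} => b' \in S) Ev; rewrite EG Eu Ew ED EC /=.
rewrite !in_mv b'B nb'y' (negPf nb'x') (eq_sym b' a') (negPf na'b') (negPf b'A) !orbT /=.
by case: eqP.
Qed.

(** The images of [a -> b] and [a -> x] share a source or a target; the second case is the first one
    for the complement of [f]. *)
Lemma star_hop f A a b x y p q : token_aut f -> y \in A -> y != a -> e a y ->
  x \notin A -> b != x -> e a x -> maps_move f A a b p q -> maps_move f (mv A y x) a b p q.
Proof.
move=> fa yA nya eay xA nbx eax Hab; have [mab _ _] := Hab; have [aA _ _] := and3P mab.
have max : moves A a x by apply/and3P.
have [r [s Hax]] := maps_move_ex fa max.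
have := maps_move_disjoint fa Hab Hax; rewrite eqxx.
case: (eqVneq p r) => [E _|_ /esym/negbFE/eqP E].
  by subst r; apply: star_hop_aux Hab Hax.
subst s; have := star_hop_aux (aut_setC fa) yA nya eay nbx (maps_move_setC Hab) (maps_move_setC Hax).
move/maps_move_setC; case=> m m' E; split=> //; first by move: m'; rewrite setCK.
by move: E; rewrite !setCK.
Qed.

(* With tokens c = y, d = x, the moves on the path c - a - b - d form a square with two
   pendant edges, both labelled ab; a mismatch of their images would create a third
   common neighbour of the two corners carrying the pendant edges. *)
Lemma path_hop f A a b x y p q : token_aut f -> y \in A -> y != a -> e a y ->
  x \notin A -> b != x -> e b x -> ~~ e y x ->
  maps_move f A a b p q -> maps_move f (mv A y x) a b p q.
Proof.
move=> fa yA nya eay xA nbx ebx nyx Hab.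
have [mab mab' EB] := Hab; have [aA bA eab] := and3P mab.
have nab := moves_neq mab.
have nyb : y != b by apply: contraNneq bA => <-.
have nax : a != x by apply: contraNneq xA => <-.
have nyx' : y != x by apply: contraNneq xA => <-.
set P := mv A a b in EB *.
have mP1 : moves P y a.
  by rewrite /moves /P !in_mv (e_sym y) eay; clear -aA yA nya nyb nab; mem_cases.
have mP3 : moves P b x.
  by rewrite /moves /P !in_mv ebx; clear -aA xA nax nbx; mem_cases.
have HP2 : maps_move f P b a q p by apply: maps_move_back.
have [p1 [q1 HP1]] := maps_move_ex fa mP1; have [p3 [q3 HP3]] := maps_move_ex fa mP3.
have := maps_move_disjoint fa HP1 HP3; rewrite nyb nax => /esym/andP[n13 m13].
have H1 := maps_move_slide fa HP1 mP3 nyb nax.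
have nby : b != y by rewrite eq_sym.
have nxa : x != a by rewrite eq_sym.
have H3 := maps_move_slide fa HP3 mP1 nby nxa.
have EQ : mv A y x = mv (mv P b x) y a.
  by rewrite /P; apply/setP=> t; rewrite !in_mv;
  clear -aA xA yA bA nyb nbx nya nab nax nyx'; mem_cases.
have EQ' : mv (mv P y a) b x = mv (mv P b x) y a.
  by have [? ? _] := and3P mP1; have [? ? _] := and3P mP3; rewrite mvC // eq_sym.
have {}H1 := maps_move_back H1; have {}H3 := maps_move_back H3.
rewrite -EQ in H1; rewrite EQ' -EQ in H3.
have mQ : moves (mv A y x) a b.
  by rewrite /moves !in_mv eab; clear -aA bA nya nbx; mem_cases.
have [i [j HQ]] := maps_move_ex fa mQ.
have /esym i1 := maps_move_disjoint fa HP2 HP1; rewrite eqxx andbF in i1.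
have /esym i3 := maps_move_disjoint fa HP2 HP3; rewrite eqxx /= in i3.
have /esym j1 := maps_move_disjoint fa HQ H1; rewrite eqxx /= in j1.
have /esym j3 := maps_move_disjoint fa HQ H3; rewrite eqxx andbF in j3.
have [_ m1 _] := HP1; have [_ m3 _] := HP3; have [_ mij _] := HQ.
have [p1P q1P _] := and3P m1; have [p3P q3P _] := and3P m3; have [_ _ eij] := and3P mij.
(* The preimage of such a move meets both [y -> a] and [b -> x]. So it is [y -> x], which is not
   along an edge, or [b -> a], whose image starts at [q]. *)
have no_chord s t : q != s -> (p1 != s) && (q1 != t) = false ->
    (p3 != s) && (q3 != t) = false -> s \in f P -> t \notin f P -> e s t -> False.
  move=> nqs c1 c3 sP tP est.
  have [u [v K]] : exists u v, maps_move f P u v s t by apply: maps_move_onto => //; apply/and3P.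
  have := maps_move_disjoint fa HP1 K; have := maps_move_disjoint fa HP3 K; rewrite c1 c3.
  case: (eqVneq b u) K => [<-|_] K /=; last first.
    move/negbFE/eqP=> xv; case: (eqVneq y u) K => [yu|_] K /=.
      by have [/and3P[_ _ euv] _ _] := K; rewrite yu xv euv in nyx.
    by move/negbFE/eqP=> av; rewrite av xv eqxx in nax.
  move=> _; rewrite nyb => /negbFE/eqP av; subst v.
  by have [E _] := maps_move_fun HP2 K; rewrite E eqxx in nqs.
suff [-> ->] : p = i /\ q = j by [].
have [_ mqp _] := HP2; have [qP pP epq] := and3P mqp.
(* Meeting two disjoint moves leaves two possibilities for [q -> p] and two for [i -> j]. Matching
   ones give the claim; for mixed ones the reversed edge [j -> i] is a move excluded by
   [no_chord]. *)
case: (eqVneq q p1) i1 => [qp1 _|nqp1] /=; last first.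
  move/negbFE/eqP=> pq1; move: i3; rewrite pq1 m13 andbT => /negbFE/eqP qp3.
  case: (eqVneq i q1) j1 => [iq1 _|niq1] /=; last first.
    move/negbFE/eqP=> jp1; move: j3; rewrite jp1 n13 andbT => /negbFE/eqP iq3.
    case: (no_chord p1 q3); rewrite ?eqxx ?andbF //.
    by rewrite e_sym -iq3 -jp1.
  by move: j3; rewrite iq1 m13 => /negbFE/eqP ->.
move: i3; rewrite qp1 n13 => /negbFE/eqP pq3.
case: (eqVneq i q1) j1 => [iq1 _|niq1] /=; last first.
  move/negbFE/eqP=> jp1; move: j3; rewrite jp1 n13 andbT => /negbFE/eqP iq3.
  by rewrite pq3 iq3.
move: j3; rewrite iq1 m13 => /negbFE/eqP jp3.
case: (no_chord p3 q1); rewrite ?eqxx ?andbF ?qp1 //.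
by rewrite e_sym -iq1 -jp3.
Qed.

Definition endpoint a b w := e a w || e b w.

(** An edge between [y] and [x] gives a square; otherwise a star hexagon or a path applies, to the
    reversed move [b -> a] if [y] is attached to [b] only. *)
Lemma near_hop f A a b x y p q : token_aut f -> y \in A -> y != a -> y != b ->
  x \notin A -> x != a -> x != b -> e y x \/ endpoint a b y && endpoint a b x ->
  maps_move f A a b p q -> maps_move f (mv A y x) a b p q.
Proof.
move=> fa yA nya nyb xA nxa nxb H Hab; have [mab _ _] := Hab.
have nay : a != y by rewrite eq_sym.
have nby : b != y by rewrite eq_sym.
have nbx : b != x by rewrite eq_sym.
have nax : a != x by rewrite eq_sym.
have [aA bA eab] := and3P mab; have nab := moves_neq mab.
case: (boolP (e y x)) H => [eyx _|nyx [//|]].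
  by apply: (maps_move_slide fa Hab) => //; apply/and3P.
have Hba := maps_move_back Hab.
have yB : y \in mv A a b by rewrite in_mv yA nya orbT.
have xB : x \notin mv A a b by rewrite in_mv (negPf nxb) (negPf xA).
have EQ : mv (mv (mv A a b) y x) b a = mv A y x.
  by apply/setP=> t; rewrite !in_mv; clear -aA bA xA yA nay nax nbx nby nab; mem_cases.
case/andP; rewrite /endpoint; case: (boolP (e a y)) => [eay _|_ /= eby].
  case: (boolP (e a x)) => [eax _|_ /= ebx]; first exact: star_hop Hab.
  exact: path_hop Hab.
rewrite -EQ; case: (boolP (e b x)) => [ebx _|_]; last rewrite orbF => eax.
  exact/maps_move_back/(star_hop fa _ _ _ _ _ _ Hba).
exact/maps_move_back/(path_hop fa _ _ _ _ _ _ _ Hba).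
Qed.

Lemma card_mv A u v : u \in A -> v \notin A -> #|mv A u v| = #|A|.
Proof. by move=> uA vA; rewrite /mv cardsU1 (cardsD1 u A) uA !inE (negPf vA) andbF. Qed.

(* P is invariant under moving a token from y to x, whatever the other tokens are. *)
Definition exchange (P : {set V} -> Prop) y x :=
  forall A, y \in A -> x \notin A -> P A -> P (mv A y x).

Lemma exchange_id P y : exchange P y y.
Proof. by move=> A ->. Qed.

(** If [z] is free, move [y] to [z] and then on to [x]. If it is occupied, move its token to [x]
    first and refill it from [y]. *)
Lemma exchange_trans P y z x : exchange P y z -> exchange P z x -> exchange P y x.
Proof.
move=> Hyz Hzx A yA xA HA; case: (boolP (z \in A)) => zA.
  case: (eqVneq z y) => [<-|nzy]; first exact: Hzx.
  have yA' : y \in mv A z x by rewrite in_mv yA (eq_sym y z) nzy orbT.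
  have nzx : z != x by apply: contraNneq xA => <-.
  have zA' : z \notin mv A z x by rewrite in_mv (negPf nzx) eqxx andbF.
  have := Hyz _ yA' zA' (Hzx _ zA xA HA).
  suff -> : mv (mv A z x) y z = mv A y x by [].
  by apply/setP=> t; rewrite !in_mv; clear -yA xA zA nzy nzx; mem_cases.
case: (eqVneq z x) => [<-|nzx]; first exact: Hyz.
have zA' : z \in mv A y z by rewrite in_mv eqxx.
have xA' : x \notin mv A y z by rewrite in_mv (eq_sym x z) (negPf nzx) (negPf xA).
by have := Hzx _ zA' xA' (Hyz _ yA zA HA); rewrite mv_mv.
Qed.

(** Tokens are moved one by one from the difference of [A] and [A'] into that of [A'] and [A].
    Exchanges are demanded only between these differences, so vertices on which the two sets agree
    are never touched. *)
Lemma exchange_level P A A' :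
  {in A :\: A' & A' :\: A, forall y x, exchange P y x} ->
  #|A'| = #|A| -> P A -> P A'.
Proof.
have [n] := ubnP #|A :\: A'|; elim: n A => // n IHn A lt_n HP cA PA.
case: (set_0Vmem (A :\: A')) => [/eqP|[y yAA']].
  rewrite setD_eq0 => sA.
  by suff -> : A' = A by []; apply/esym/eqP; rewrite eqEcard sA cA leqnn.
have [yA' yA] : y \notin A' /\ y \in A by move: yAA'; rewrite inE => /andP.
have [x xAA'] : exists x, x \in A' :\: A.
  apply/set0Pn; rewrite -card_gt0 cardsD setIC cA -cardsD card_gt0.
  by apply/set0Pn; exists y.
have [xA xA'] : x \notin A /\ x \in A' by move: xAA'; rewrite inE => /andP.
have nyx : y != x by apply: contraNneq xA => <-.
apply: (IHn (mv A y x)); rewrite ?card_mv //; last exact: HP.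
  rewrite ltnS in lt_n; apply: leq_trans lt_n; apply: proper_card; apply/properP; split.
    apply/subsetP=> t; rewrite !inE => /andP[tA' /orP[/eqP tx|/andP[_ ->]]];
      last by rewrite tA'.
    by rewrite tx xA' in tA'.
  by exists y; rewrite !inE ?yA' ?yA ?eqxx // (negPf nyx).
move=> y' x'; rewrite !inE negb_or => /andP[y'A' H] /andP[/andP[nx'x H'] x'A'].
apply: HP; rewrite !inE ?y'A' ?x'A' ?andbT /=.
  by case/orP: H => [/eqP y'x|/andP[]//]; rewrite y'x xA' in y'A'.
by apply: contraNN H' => ->; rewrite andbT; apply: contraNneq yA' => <-.
Qed.

(** A path from a vertex towards [a], cut before it first enters [{a, b}], ends at a neighbour of
    [a] or [b]. Exchanges along its edges are squares, and the two ends reached from [y] and [x] are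
    linked by [near_hop]. *)
Lemma maps_move_exchange f a b p q y x : token_aut f -> e a b ->
  y \notin [:: a; b] -> x \notin [:: a; b] -> exchange (fun A => maps_move f A a b p q) y x.
Proof.
move=> fa eab; set ex := exchange _.
have near w z : w \notin [:: a; b] -> z \notin [:: a; b] ->
    e w z \/ endpoint a b w && endpoint a b z -> ex w z.
  rewrite !inE !negb_or => /andP[nwa nwb] /andP[nza nzb] H A wA zA.
  exact: near_hop.
have to_end w : w \notin [:: a; b] -> exists z,
    [/\ z \notin [:: a; b], endpoint a b z, ex w z & ex z w].
  move=> nw; have [s pth ew] := connectP (conn w a).
  elim: s w nw pth ew => [w nw _ /= aw|z s IHs w nw /= /andP[ewz pth] az].
    by rewrite -aw !inE eqxx in nw.
  case: (boolP (z \in [:: a; b])) => nz.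
    exists w; split; [by []| |exact: exchange_id|exact: exchange_id].
    by move: nz ewz; rewrite /endpoint !inE e_sym => /orP[] /eqP -> ->; rewrite ?orbT.
  have [t [nt et h1 h2]] := IHs z nz pth az.
  exists t; split=> //.
    by apply: exchange_trans h1; apply: near => //; left.
  by apply: exchange_trans h2 _; apply: near => //; left; rewrite e_sym.
move=> /to_end[n [nn en yn _]] /to_end[n' [nn' en' _ xn]].
apply: exchange_trans yn _; apply: exchange_trans xn; apply: near => //.
by right; rewrite en en'.
Qed.

Lemma maps_move_level f A A' a b p q : token_aut f -> maps_move f A a b p q ->
  a \in A' -> b \notin A' -> #|A'| = #|A| -> maps_move f A' a b p q.
Proof.
move=> fa HA aA' bA' cA; have [mab _ _] := HA; have [aA bA eab] := and3P mab.
apply: (@exchange_level (fun A => maps_move f A a b p q) A A' _ cA HA) => y x.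
rewrite !inE => /andP[yA' yA] /andP[xA xA'].
apply: maps_move_exchange; rewrite // !inE negb_or.
  by apply/andP; split; [apply: contraNneq yA' => ->|apply: contraNneq bA => <-].
by apply/andP; split; [apply: contraNneq xA => ->|apply: contraNneq bA' => <-].
Qed.

Lemma exists_separating_set (s t : seq V) k : ~~ has [in s] t -> size s <= k -> k + size t <= #|V| ->
  exists A, [/\ all [in A] s, all [predC A] t & #|A| = k].
Proof.
move=> dst lsk lkt.
have cT : #|[set x in t]| <= size t by rewrite cardsE card_size.
suff [A [sA tA cA]] : exists A, [/\ {subset s <= A}, [disjoint A & [set x in t]] & #|A| = k].
  exists A; split=> //; first exact/allP.
  apply/allP=> x xt; rewrite inE; apply: contraTN tA => xA.
  by apply/pred0Pn; exists x; rewrite /= xA inE.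
have {}lsk : #|[set x in s]| <= k by rewrite cardsE (leq_trans (card_size _)).
elim: k lsk lkt => [|k IHk] lsk lkt; last move: lsk; last rewrite leq_eqVlt.
- exists set0; split; rewrite ?cards0 //; last by rewrite disjoints_subset sub0set.
  by move=> x xs; move: lsk; rewrite leqn0 cards_eq0 => /eqP/setP/(_ x); rewrite !inE xs.
- case/orP=> [/eqP cs|lsk].
    exists [set x in s]; split=> // [x|]; first by rewrite inE.
    rewrite disjoint_subset; apply/subsetP=> x; rewrite !inE => xs.
    by apply: contraNN dst => xt; apply/hasP; exists x.
  have [A [sA dA cA]] := IHk lsk (ltnW lkt).
  have [x] : exists x, x \in ~: (A :|: [set x in t]).
    apply/set0Pn; rewrite -card_gt0 cardsCs setCK subn_gt0.
    apply: leq_ltn_trans (leq_card_setU _ _) _; rewrite cA.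
    by apply: leq_ltn_trans (leq_add (leqnn _) cT) _.
  rewrite in_setC in_setU negb_or => /andP[xA xt]; exists (x |: A); split.
  + by move=> y /sA; rewrite inE => ->; rewrite orbT.
  + by rewrite disjoints_subset subUset sub1set inE xt -disjoints_subset.
  + by rewrite cardsU1 xA cA.
Qed.
(** * The vertex map *)

Section Level.
Variables (f : {set V} -> {set V}) (k : nat).
Hypotheses (f_aut : token_aut f) (k_bounds : 0 < k < #|V|).

(* By maps_move_level the set A is irrelevant: f acts on the oriented edges of the graph. *)
Definition edge_map a b p q := exists A, #|A| = k /\ maps_move f A a b p q.

Lemma edge_map_at a b p q A : edge_map a b p q ->
  #|A| = k -> a \in A -> b \notin A -> maps_move f A a b p q.
Proof. by case=> A0 [cA0 H0] cA aA bA; apply: maps_move_level H0 _ _ _; rewrite // cA cA0. Qed.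

Lemma edge_map_edge a b p q : edge_map a b p q -> e a b /\ e p q.
Proof. by case=> A [_ [/and3P[_ _ ->] /and3P[_ _ ->] _]]. Qed.

Lemma edge_map_sym a b p q : edge_map a b p q -> edge_map b a q p.
Proof.
case=> A [cA H]; exists (mv A a b); split; last exact: maps_move_back.
by case: H => /and3P[aA bA _] _ _; rewrite card_mv.
Qed.

Lemma edge_map_ex a b : e a b -> exists p q, edge_map a b p q.
Proof.
move=> eab; have nab := edge_neq eab; case/andP: k_bounds => k0 kV.
have [|||A [/= /andP[aA _] /andP[bA _] cA]] := @exists_separating_set [:: a] [:: b] k.
- by rewrite /= !inE orbF eq_sym.
- by [].
- by rewrite addn1.
have m : moves A a b by rewrite /moves aA bA.
by have [p [q H]] := maps_move_ex f_aut m; exists p, q, A.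
Qed.

Lemma edge_map_fun a b p q p' q' : edge_map a b p q -> edge_map a b p' q' -> p = p' /\ q = q'.
Proof.
case=> A [cA H] L; have [/and3P[aA bA _] _ _] := H.
exact: maps_move_fun H (edge_map_at L cA aA bA).
Qed.

(** Both moves can be tested at one set: a token on [a] and holes at [b], [c] need [k] at most
    [#|V| - 2]. For [k = #|V| - 1] the reversed moves are used, with tokens on [b], [c] and the hole
    at [a]. *)
Lemma edge_map_incident a b c p q p' q' : b != c -> edge_map a b p q -> edge_map a c p' q' ->
  (p == p') = (q != q').
Proof.
move=> nbc L L'; have [eab _] := edge_map_edge L; have [eac _] := edge_map_edge L'.
have nab := edge_neq eab; have nac := edge_neq eac.
have V3 : 2 < #|V|.
  have : uniq [:: a; b; c] by rewrite /= !inE negb_or nab nac nbc.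
  by move/card_uniqP=> /= <-; apply: max_card.
case/andP: k_bounds => k0 kV; case: (ltnP k #|V|.-1) => [k_lt|k_ge].
  have [|||A [/= /andP[aA _] /and3P[bA cnA _] cA]] := @exists_separating_set [:: a] [:: b; c] k.
  - by rewrite /= !inE orbF (eq_sym b) (eq_sym c) negb_or nab nac.
  - by [].
  - by rewrite addn2 -ltn_predRL.
  have H := edge_map_at L cA aA bA; have H' := edge_map_at L' cA aA cnA.
  have := maps_move_disjoint f_aut H H'; rewrite eqxx /=.
  case: eqP H => [->|_] H; last by move/esym => /= ->.
  move=> _; apply/esym; case: eqP H => [->|//] [_ _ E]; case: H' => _ _ E'.
  have /(aut_inj f_aut)/setP/(_ b) : f (mv A a b) = f (mv A a c) by rewrite E E'.
  by rewrite !in_mv eqxx (negPf nbc) (negPf bA).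
have [|||A [/= /and3P[bA cnA _] /andP[aA _] cA]] := @exists_separating_set [:: b; c] [:: a] k.
- by rewrite /= !inE orbF negb_or nab nac.
- by apply: leq_trans k_ge; rewrite ltn_predRL.
- by rewrite addn1.
have H := edge_map_at (edge_map_sym L) cA bA aA; have H' := edge_map_at (edge_map_sym L') cA cnA aA.
have := maps_move_disjoint f_aut H H'; rewrite eqxx andbF.
case: eqP H => [->|_] H.
  move=> _; case: eqP H => [->|//] [_ _ E]; case: H' => _ _ E'.
  have /(aut_inj f_aut)/setP/(_ b) : f (mv A b a) = f (mv A c a) by rewrite E E'.
  by rewrite !in_mv (eq_sym b a) (negPf nab) eqxx bA nbc.
by move/esym/negbFE->.
Qed.

(* The two ways in which f can map the star of a to a star: keeping tokens and holes, or
   exchanging them as the composition with complementation does. *)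
Definition sources_agree a := forall b c p q p' q',
  b != c -> edge_map a b p q -> edge_map a c p' q' -> p = p'.
Definition targets_agree a := forall b c p q p' q',
  b != c -> edge_map a b p q -> edge_map a c p' q' -> q = q'.
Definition inner a := [exists b, exists c, [&& b != c, e a b & e a c]].

Lemma innerP a : reflect (exists b c, [/\ b != c, e a b & e a c]) (inner a).
Proof.
apply: (iffP existsP) => [[b /existsP[c /and3P H]]|[b [c H]]]; first by exists b, c.
by exists b; apply/existsP; exists c; apply/and3P.
Qed.

Lemma outer_eq a b c : ~~ inner a -> e a b -> e a c -> b = c.
Proof.
move=> na eab eac; apply: contraNeq na => nbc; apply/innerP.
by exists b, c.
Qed.

(** Two edges at [a] decide: if their images share the source, a third image with another source
    would share its target with both, whereas their targets differ. The case of a common target is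
    symmetric. *)
Lemma sources_or_targets_agree a : sources_agree a \/ targets_agree a.
Proof.
case: (boolP (inner a)) => [/innerP[b [c [nbc eab eac]]]|na]; last first.
  left=> b c p q p' q' nbc /edge_map_edge[eab _] /edge_map_edge[eac _].
  by rewrite (outer_eq na eab eac) eqxx in nbc.
have [p [q Lb]] := edge_map_ex eab; have [p' [q' Lc]] := edge_map_ex eac.
have := edge_map_incident nbc Lb Lc; case: eqP => [E nq|np /esym/negbFE/eqP E].
  have all_p d r s : edge_map a d r s -> r = p.
    move=> L; case: (eqVneq b d) => [bd|nbd].
      by subst d; have [] := edge_map_fun L Lb.
    case: (eqVneq c d) => [cd|ncd].
      by subst d; rewrite E; have [] := edge_map_fun L Lc.
    have := edge_map_incident nbd Lb L; have := edge_map_incident ncd Lc L; rewrite -E.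
    case: eqP => [->//|_] /esym/negbFE/eqP q's /esym/negbFE/eqP qs.
    by rewrite qs q's eqxx in nq.
  by left=> ? ? ? ? ? ? _ /all_p-> /all_p->.
have all_q d r s : edge_map a d r s -> s = q.
  move=> L; case: (eqVneq b d) => [bd|nbd].
    by subst d; have [] := edge_map_fun L Lb.
  case: (eqVneq c d) => [cd|ncd].
    by subst d; rewrite E; have [] := edge_map_fun L Lc.
  have := edge_map_incident nbd Lb L; have := edge_map_incident ncd Lc L; rewrite -E.
  case: (eqVneq q s) => [->//|_] /eqP p'r /eqP pr.
  by case: np; rewrite pr p'r.
by right=> ? ? ? ? ? ? _ /all_q-> /all_q->.
Qed.

Hypothesis f_card : forall A, #|f A| = #|A|.

(* On a path c - a - b - d the image p of a in the star of a would be both the source of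
   a move at f A and the target of another one, when A contains a, b but not c, d; the
   extreme values of k leave too few tokens or holes. *)
Lemma agreement_clash a b : e a b -> inner a -> inner b -> sources_agree a -> ~ targets_agree b.
Proof.
move=> eab ia ib pa mb; have nab := edge_neq eab.
have other u v : e u v -> inner u -> exists w, v != w /\ e u w.
  move=> euv /innerP[x [y [nxy eux euy]]].
  case: (eqVneq v x) => [vx|nvx]; last by exists x.
  by exists y; rewrite vx.
have eba : e b a by rewrite e_sym.
have [c [nbc eac]] := other a b eab ia; have [d [nad ebd]] := other b a eba ib.
have [p [q Lab]] := edge_map_ex eab; have [p' [q1 Lac]] := edge_map_ex eac.
have Ep := pa _ _ _ _ _ _ nbc Lab Lac; subst p'.
have [r [p' Lbd]] := edge_map_ex ebd; have Lba := edge_map_sym Lab.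
have Ep := mb _ _ _ _ _ _ nad Lba Lbd; subst p'.
have nqr : q != r.
  by have := edge_map_incident nad Lba Lbd; rewrite eqxx /= => ->.
have nqq1 : q != q1 by have := edge_map_incident nbc Lab Lac; rewrite eqxx.
have [_ epq1] := edge_map_edge Lac; have [_ erp] := edge_map_edge Lbd.
have nac := edge_neq eac; have nbd := edge_neq ebd.
(* In a triangle the moves [c -> a] and [c -> b] would have images [q1 -> p] and [p -> r], with
   neither a common source nor a common target. *)
case: (eqVneq c d) => [cd|ncd].
  subst d; have := edge_map_incident nab (edge_map_sym Lac) (edge_map_sym Lbd).
  rewrite (eq_sym q1) (negPf (edge_neq epq1)) => /esym/negbFE/eqP pr.
  by rewrite pr e_irr in erp.
have V4 : 3 < #|V|.
  have : uniq [:: a; b; c; d] by rewrite /= !inE !negb_or nab nac nad nbc nbd ncd.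
  by move/card_uniqP=> /= <-; apply: max_card.
case/andP: k_bounds => k0 kV; case: (eqVneq k 1) => [k1|nk1].
  have [|||A [/= /andP[bA _] /and3P[aA dA _] cA]] := @exists_separating_set [:: b] [:: a; d] k.
  - by rewrite /= !inE orbF negb_or nab eq_sym nbd.
  - by [].
  - by rewrite k1 ltnW.
  have [_ /and3P[qA _ _] _] := edge_map_at Lba cA bA aA.
  have [_ /and3P[rA _ _] _] := edge_map_at Lbd cA bA dA.
  have /card_le1P/(_ _ qA r) : #|f A| <= 1 by rewrite f_card cA k1.
  by rewrite rA inE eq_sym (negPf nqr).
have k2 : 1 < k by rewrite ltn_neqAle eq_sym nk1.
case: (eqVneq k #|V|.-1) => [kV1|nkV1].
  have [|||A [/= /and3P[aA dA _] /andP[bA _] cA]] := @exists_separating_set [:: a; d] [:: b] k.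
  - by rewrite /= !inE orbF negb_or eq_sym nab nbd.
  - by [].
  - by rewrite addn1.
  have [_ /and3P[_ qA _] _] := edge_map_at Lab cA aA bA.
  have [_ /and3P[_ rA _] _] := edge_map_at (edge_map_sym Lbd) cA dA bA.
  have /card_le1P : #|~: f A| <= 1.
    by rewrite cardsCs setCK f_card cA kV1; case: #|V| V4 => // n _; rewrite subSnn.
  move/(_ q); rewrite inE => /(_ qA r); rewrite !inE rA eq_sym.
  by rewrite (negPf nqr).
have [|||A [/= /and3P[aA bA _] /and3P[cnA dA _] cA]] := @exists_separating_set [:: a; b] [:: c; d] k.
- by rewrite /= !inE orbF !negb_or (eq_sym c) nac (eq_sym c) nbc (eq_sym d) nad (eq_sym d).
- by [].
- by rewrite addn2 -ltn_predRL ltn_neqAle nkV1 -ltnS (ltn_predK kV).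
have [_ /and3P[pA _ _] _] := edge_map_at Lac cA aA cnA.
have [_ /and3P[_ npA _] _] := edge_map_at Lbd cA bA dA.
by rewrite pA in npA.
Qed.

(** Only inner vertices pass [S] on. A path entering an outer vertex can only return to the inner
    vertex it came from, which satisfies [S] already. *)
Lemma spread (S : V -> Prop) a : (forall u v, e u v -> inner u -> S u -> S v) ->
  inner a -> S a -> forall v, S v.
Proof.
move=> Sstep ia Sa v; have [s pth ->] := connectP (conn a v).
suff [] : S (last a s) /\ (inner (last a s) \/
    exists u, [/\ inner u, S u, ~~ inner (last a s) & e (last a s) u]) by [].
elim/last_ind: s pth => [_|s w IHs]; first by split; last left.
rewrite rcons_path last_rcons => /andP[/IHs[Sl H] elw].
case: H => [il|[u [iu Su nil elu]]]; last by rewrite (outer_eq nil elw elu); split; last left.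
split; first exact: Sstep elw il Sl.
case: (boolP (inner w)) => iw; [by left|right].
by exists (last a s); split; rewrite // e_sym.
Qed.

(** At a vertex with at most one neighbour both kinds of agreement hold vacuously; between adjacent
    inner vertices [agreement_clash] forbids a change of kind. *)
Lemma uniform_agreement : (forall a, sources_agree a) \/ (forall a, targets_agree a).
Proof.
case: (boolP [exists a, inner a]) => [/existsP[a ia]|/existsPn ni]; last first.
  left=> a b c p q p' q' nbc /edge_map_edge[eab _] /edge_map_edge[eac _].
  by rewrite (outer_eq (ni a) eab eac) eqxx in nbc.
case: (sources_or_targets_agree a) => Sa; [left|right]; apply: spread ia Sa => u v euv iu Su.
  case: (sources_or_targets_agree v) => // mv.
  case: (boolP (inner v)) => iv; first by case: (agreement_clash euv iu iv Su mv).
  move=> b c p q p' q' nbc /edge_map_edge[eab _] /edge_map_edge[eac _].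
  by rewrite (outer_eq iv eab eac) eqxx in nbc.
case: (sources_or_targets_agree v) => // pv.
case: (boolP (inner v)) => iv.
  by rewrite e_sym in euv; case: (agreement_clash euv iv iu pv Su).
move=> b c p q p' q' nbc /edge_map_edge[eab _] /edge_map_edge[eac _].
by rewrite (outer_eq iv eab eac) eqxx in nbc.
Qed.

End Level.

(** * From oriented edges to an automorphism of the graph *)

Lemma has_edge v : 1 < #|V| -> exists w, e v w.
Proof.
move=> V2; have [u nuv] : exists u, u != v.
  have : 0 < #|~: [set v]| by rewrite cardsC1 -ltnS prednK // ltnW.
  by case/card_gt0P=> u; rewrite !inE; exists u.
have [[|w s] /= pth E] := connectP (conn v u); first by rewrite E eqxx in nuv.
by exists w; case/andP: pth.
Qed.

(** The size [l] of the images is kept separate from [k] so that the lemma also covers the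
    complement of an automorphism, with [l = #|V| - k]. *)
Lemma induced_of_sources_agree f k l : token_aut f -> 0 < k < #|V| -> 0 < l < #|V| ->
  (forall A, (#|f A| == l) = (#|A| == k)) -> (forall a, sources_agree f k a) ->
  exists s, graph_aut e s /\ forall A, #|A| = k -> f A = s @: A.
Proof.
move=> fa kb lb fcard fp; have V2 : 1 < #|V| by case/andP: kb => k0; apply: leq_ltn_trans.
have [s sP] : exists s : V -> V, forall a b p q, edge_map f k a b p q -> p = s a.
  apply: (@fin_all_exists _ (fun=> V) (fun a x => forall b p q, edge_map f k a b p q -> p = x)) => a.
  have [b eab] := has_edge a V2; have [p [q L]] := edge_map_ex fa kb eab.
  exists p => b' p' q' L'; case: (eqVneq b b') => [bb|nbb].
    by subst b'; have [] := edge_map_fun fa L' L.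
  by rewrite (fp _ _ _ _ _ _ _ nbb L L').
have edge_mapE a b : e a b -> edge_map f k a b (s a) (s b).
  move=> eab; have [p [q L]] := edge_map_ex fa kb eab.
  by rewrite -(sP _ _ _ _ L) -(sP _ _ _ _ (edge_map_sym L)).
have maps_moveE A a b : #|A| = k -> moves A a b -> maps_move f A a b (s a) (s b).
  by move=> cA /and3P[aA bA eab]; apply: (edge_map_at fa (edge_mapE _ _ eab)).
(* A set of size [l] with a token on [w] and a hole at a neighbour is pulled back through [f]; the
   preimage of the move shows [w] as a source. *)
have s_sur w : exists v, s v == w.
  have [w' eww'] := has_edge w V2; have nww' := edge_neq eww'.
  case/andP: lb => l0 lV.
  have [|||A' [/= /andP[wA _] /andP[wA' _] cA']] := @exists_separating_set [:: w] [:: w'] l.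
  - by rewrite /= !inE orbF eq_sym.
  - by [].
  - by rewrite addn1.
  have [[g fK gK] _] := fa.
  have m : moves (f (g A')) w w' by rewrite gK; apply/and3P.
  have [u [v H]] := maps_move_onto fa m; exists u; apply/eqP/esym/(sP _ v _ w').
  by exists (g A'); split=> //; apply/eqP; rewrite -fcard gK cA'.
have [t tK] := fin_all_exists s_sur.
have {}tK : cancel t s by move=> w; apply/eqP.
have s_bij : bijective s := bij_can_bij (injF_bij (can_inj tK)) tK.
have s_inj := bij_inj s_bij.
(* The equivalence holds at one set from which [a] can move, and it survives every move along an
   edge; connectedness carries it to all sets of size [k]. *)
have mem_f A a : #|A| = k -> (s a \in f A) = (a \in A).
  move=> cA; have [b eab] := has_edge a V2; have nab := edge_neq eab.
  case/andP: (kb) => k0 kV.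
  have [|||A0 [/= /andP[aA _] /andP[bA _] cA0]] := @exists_separating_set [:: a] [:: b] k.
  - by rewrite /= !inE orbF eq_sym.
  - by [].
  - by rewrite addn1.
  pose P B := #|B| = k /\ (s a \in f B) = (a \in B).
  suff [] : P A by [].
  apply: (@exchange_level P A0); rewrite ?cA0 //; last first.
    have m0 : moves A0 a b by apply/and3P.
    by have [_ /and3P[sA0 _ _] _] := maps_moveE _ _ _ cA0 m0; split; rewrite ?sA0.
  move=> y x _ _; have [c pth ->] := connectP (conn y x).
  elim: c y pth => [y _|z c IHc y /= /andP[eyz pth]]; first exact: exchange_id.
  apply: exchange_trans (IHc z pth) => B yB zB [cB HB].
  have m : moves B y z by apply/and3P.
  have [_ _ E] := maps_moveE _ _ _ cB m.
  by split; rewrite ?card_mv // E !in_mv !(inj_eq s_inj) HB.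
have fE A : #|A| = k -> f A = s @: A.
  move=> cA; apply/setP=> w; rewrite -(tK w) mem_f //.
  by rewrite (mem_imset _ _ s_inj).
exists s; split=> //; split=> // x y; apply/idP/idP => [exy|exy]; last first.
  by have [] := edge_map_edge (edge_mapE _ _ exy).
have nxy : x != y by apply: contraTneq exy => ->; rewrite e_irr.
case/andP: (kb) => k0 kV.
have [|||A [/= /andP[xA _] /andP[yA _] cA]] := @exists_separating_set [:: x] [:: y] k.
- by rewrite /= !inE orbF eq_sym.
- by [].
- by rewrite addn1.
(* The images differ by a move along the edge from [s x] to [s y]. Since [f] reflects adjacency,
   [mv A x y] is also reached from [A] along an edge, which must join [x] and [y]. *)
have : adj (f A) (f (mv A x y)).
  apply/adjP; exists (s x), (s y); split.
    by rewrite /moves !mem_f // xA yA.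
  rewrite !fE ?card_mv //; apply/setP=> w; rewrite -(tK w) in_mv.
  by rewrite !(mem_imset _ _ s_inj) !(inj_eq s_inj) in_mv.
rewrite (proj2 fa) => /adjP[u [v [/and3P[uA vA euv] E]]].
have Ex := congr1 (fun S : {set V} => x \in S) E.
have Ey := congr1 (fun S : {set V} => y \in S) E.
rewrite /= !in_mv !eqxx xA (negPf nxy) /= in Ex; rewrite /= !in_mv eqxx (negPf yA) /= orbF in Ey.
move/esym/eqP: Ey => yv; rewrite yv in nxy *.
by move: Ex; rewrite (negPf nxy) /= => /esym/negbFE/eqP ->.
Qed.

Lemma level_rigidity f k : token_aut f -> 0 < k < #|V| -> (forall A, #|f A| = #|A|) ->
  exists s, graph_aut e s /\
    ((forall A, #|A| = k -> f A = s @: A) \/ (forall A, #|A| = k -> f A = ~: (s @: A))).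
Proof.
move=> fa kb fcard; have [fp|fm] := uniform_agreement fa kb fcard.
  have [|s [sa sE]] := induced_of_sources_agree fa kb kb _ fp; first by move=> A; rewrite fcard.
  by exists s; split=> //; left.
(* When targets agree, the complement of [f] has agreeing sources. *)
have [||a b c p q p' q' nbc [A [cA H]] [A' [cA' H']]|s [sa sE]] :=
  @induced_of_sources_agree _ k (#|V| - k) (aut_setC fa) kb.
- by case/andP: kb => k0 kV; rewrite subn_gt0 kV ltn_subrL k0 (leq_ltn_trans _ kV).
- move=> A; rewrite cardsCs setCK fcard; case/andP: kb => _ /ltnW kV.
  by rewrite eqn_sub2lE ?max_card.
- apply: (fm a b c q p q' p' nbc); [exists A|exists A']; split=> //.
    by have := maps_move_setC H; case=> m m' E; split; rewrite // ?setCK in m' E *.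
  by have := maps_move_setC H'; case=> m m' E; split; rewrite // ?setCK in m' E *.
exists s; split=> //; right=> A cA.
by rewrite -sE // setCK.
Qed.

End TokenGraph.

(** * Back to the token graph of a fixed size *)

(** If [v] and [v'] were not adjacent, the four vertices would induce a diamond or a 4-cycle,
    according to whether [u] and [w] are adjacent. *)
Lemma adjacent_of_common_nbrs (V : finType) (e : rel V) : symmetric e -> irreflexive e ->
  C4_free e -> diamond_free e ->
  forall u w v v', u != w -> v != v' -> e u v -> e u v' -> e w v -> e w v' -> e v v'.
Proof.
move=> e_sym e_irr c4 dia u w v v' nuw nvv' euv euv' ewv ewv'.
have neq x y : e x y -> x != y by apply: contraTneq => ->; rewrite e_irr.
have nuv := neq _ _ euv; have nuv' := neq _ _ euv'.
have nwv := neq _ _ ewv; have nwv' := neq _ _ ewv'.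
apply: contraT => nevv'; case: (boolP (e u w)) => euw.
  case: dia; exists u, w, v, v'; split=> //; last by rewrite euw euv euv' ewv ewv'.
  by rewrite /= !inE !negb_or nuw nuv nuv' nwv nwv' nvv'.
case: c4; exists u, v, w, v'; split.
- by rewrite /= !inE !negb_or nuv nuw nuv' nvv' (eq_sym v) nwv nwv'.
- by rewrite euv (e_sym v) ewv ewv' e_sym euv'.
- by rewrite euw nevv'.
Qed.

(** Because the sets have equal size, one end of the edge lies in [A] only and the other in [B]
    only: otherwise one set would be properly contained in the other. *)
Lemma tok_adjE (V : finType) (e : rel V) k (A B : tok V k) : symmetric e -> irreflexive e ->
  tok_adj e A B = adj e (val A) (val B).
Proof.
move=> e_sym e_irr; move: (eqP (valP A)) (eqP (valP B)); rewrite /tok_adj.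
move: (val A) (val B) => {}A {}B cA cB.
apply/existsP/idP => [[u /existsP[v /andP[euv /eqP E]]]|/adjP[u [v [m ->]]]]; last first.
  have nuv := moves_neq e_irr m; have [uA vA euv] := and3P m.
  exists u; apply/existsP; exists v; rewrite euv; apply/eqP/setP=> w.
  by rewrite !inE; clear -uA vA nuv; mem_cases.
have inE' w : (w \in A) (+) (w \in B) = (w == u) || (w == v).
  by have /setP/(_ w) := E; rewrite !inE => <-; case: (w \in A); case: (w \in B).
have nuv : u != v by apply: contraTneq euv => ->; rewrite e_irr.
wlog uA : u v euv E inE' nuv / u \in A => [wl|].
  case: (boolP (u \in A)) => uA; first exact: (wl u v).
  case: (boolP (v \in A)) => vA.
    apply: (wl v u); rewrite // 1?e_sym 1?eq_sym //; first by rewrite E setUC.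
    by move=> w; rewrite inE' orbC.
  have /proper_card : A \proper B.
    apply/properP; split.
      apply/subsetP=> w wA; have := inE' w; rewrite wA /=.
      case: eqP => [wu|_]; first by rewrite wu (negPf uA) in wA.
      case: eqP => [wv|_ /negbFE//]; by rewrite wv (negPf vA) in wA.
    by exists u => //; have := inE' u; rewrite (negPf uA) eqxx.
  by rewrite cA cB ltnn.
have uB : u \notin B by have := inE' u; rewrite uA eqxx /= => ->.
have vA : v \notin A.
  apply/negP=> vA; suff /proper_card : B \proper A by rewrite cA cB ltnn.
  apply/properP; split; last by exists u.
  apply/subsetP=> w wB; have := inE' w; rewrite wB addbT.
  case: eqP => [->|_]; first by rewrite uA.
  by case: eqP => [->|_ /negbFE//]; rewrite vA.
apply/adjP; exists u, v; split; first exact/and3P.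
apply/setP=> w; rewrite in_mv; have := inE' w.
by case: (eqVneq w u) => [->|_]; rewrite ?uA ?(negPf uB) ?(negPf nuv) //=;
  case: eqP => [->|_] /=; rewrite ?(negPf vA) //= andbT; case: (w \in A); case: (w \in B).
Qed.

Theorem theorem4 (V : finType) (e : rel V) (k : nat) :
  simple_graph e -> connected_graph e -> C4_free e -> diamond_free e ->
  1 <= k <= #|V| - 1 ->
  uniquely_reconstructible e k.
Proof.
move=> [e_sym e_irr] conn c4 dia kb phi psi [[phi' phiK phiK'] phi_adj] [[psi' psiK psiK'] psi_adj].
have kV : 0 < k < #|V|.
  case/andP: kb => k0 k1; rewrite k0 (leq_ltn_trans k1) // ltn_subrL.
  exact: leq_trans k0 (leq_trans k1 (leq_subr _ _)).
have cn := adjacent_of_common_nbrs e_sym e_irr c4 dia.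
(* The identity on all other sizes extends a map of [k]-sets to all subsets; adjacency never joins
   sets of different sizes. *)
pose lift (h : tok V k -> tok V k) (A : {set V}) := if insub A is Some t then val (h t) else A.
have liftE h (t : tok V k) : lift h (val t) = val (h t) by rewrite /lift valK.
have lift_card h A : #|lift h A| = #|A|.
  rewrite /lift; case: insubP => [t _ <-|//].
  by rewrite (eqP (valP t)) (eqP (valP (h t))).
have liftK h h' : cancel h h' -> cancel (lift h) (lift h').
  move=> hK A; rewrite {2}/lift; case: insubP => [t _ <-|nA]; first by rewrite liftE hK.
  by rewrite /lift insubN.
have adj_card A B : adj e A B -> #|B| = #|A|.
  by case/adjP=> u [v [/and3P[uA vA _] ->]]; rewrite card_mv.
(* Equivalence of [phi] and [psi] amounts to [theta], the composite of [psi] with the inverse of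
   [phi], being induced by a graph automorphism, up to complement. *)
pose theta t := psi (phi' t); pose theta' t := phi (psi' t).
have theta_adj s t : tok_adj e (theta s) (theta t) = tok_adj e s t.
  by rewrite psi_adj -phi_adj !phiK'.
have fa : token_aut e (lift theta).
  split=> [|A B].
    by exists (lift theta'); apply: liftK => t; rewrite /theta /theta' ?psiK ?phiK ?phiK' ?psiK'.
  case: (eqVneq #|A| #|B|) => [cAB|ncAB]; last first.
    have nadj (C D : {set V}) : #|C| != #|D| -> adj e C D = false.
      by move=> n; apply: contraNF n => /adj_card ->.
    by rewrite !nadj ?lift_card.
  case: (boolP (#|A| == k)) => [cA|ncA].
    have cB : #|B| == k by rewrite -cAB.
    have -> : A = val (Sub A cA : tok V k) by rewrite SubK.
    have -> : B = val (Sub B cB : tok V k) by rewrite SubK.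
    by rewrite !liftE -!tok_adjE // theta_adj.
  by rewrite /lift !insubN // -cAB.
have [s [s_aut [sE|sE]]] := level_rigidity e_sym e_irr cn conn fa kV (lift_card _).
  exists s; split=> //; left=> A; rewrite -sE ?(eqP (valP (phi A))) //.
  by rewrite liftE /theta phiK.
exists s; split=> //; right=> A; rewrite -sE ?(eqP (valP (phi A))) //.
by rewrite liftE /theta phiK.
Qed.
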